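(* For every $n\in\mathbb{Z}^+$ and every set $S$ of positive integers, there is a bijection between $\mathrm{FR}^{\mathrm{T1}}_{n,S}$ and $\mathrm{UPF}^{\mathrm{T1}}_{n,S}$.
   Context: A parking preference $(a_1,\dots,a_n)\in[n]^n$ describes $n$ cars entering a one-way street with spots $1,\dots,n$ in the order $1,2,\dots,n$; car $i$ parks in the first unoccupied spot numbered $\ge a_i$. It is a parking function if all cars park. It is a unit interval parking function (UPF) if it is a parking function and every car $i$ parks in spot $a_i$ or spot $a_i+1$. Car $i$ is lucky if it parks in spot $a_i$. $\mathrm{UPF}^{\mathrm{T1}}_{n,S}$ is the set of unit interval parking functions of length $n$ whose number of lucky cars belongs to $S$. A Fubini ranking of length $n$ is a tuple $(b_1,\dots,b_n)\in[n]^n$ that satisfies two conditions. First, some $b_i$ equals $1$. Second, for every value $x$ occurring exactly $k>0$ times, the next larger value occurring in the tuple (if there is one) is $x+k$. The distinct values occurring are its ranks. $\mathrm{FR}^{\mathrm{T1}}_{n,S}$ is the set of Fubini rankings of length $n$ whose number of distinct ranks belongs to $S$. *)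

(* Defs.v *)
From mathcomp Require Import all_boot.
From mathcomp Require Import boolp classical_sets functions.

Set Implicit Arguments.
Unset Strict Implicit.
Unset Printing Implicit Defensive.

Local Open Scope classical_set_scope.

(* Cars are indexed by 'I_n, i.e. car i + 1 of the usual numbering is
   i : 'I_n; spots, preferences and ranks are the actual numbers 1, ..., n. *)
Definition in_range (n : nat) (a : n.-tuple nat) : Prop :=
  forall i : 'I_n, 1 <= tnth a i <= n.

(* iota x (n.+1 - x) is x, x + 1, ..., n. *)
Definition first_free (n : nat) (occ : seq nat) (x : nat) : option nat :=
  ohead [seq s <- iota x (n.+1 - x) | s \notin occ].

(* None records a car that leaves the street without parking. *)
Fixpoint outcome (n : nat) (occ a : seq nat) : seq (option nat) :=
  if a is x :: a' then
    let s := first_free n occ x in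
    s :: outcome n (if s is Some p then p :: occ else occ) a'
  else [::].

Definition park_spot (n : nat) (a : n.-tuple nat) (i : 'I_n) : option nat :=
  nth None (outcome n [::] a) i.

Definition parking_function (n : nat) (a : n.-tuple nat) : Prop :=
  in_range a /\ forall i : 'I_n, park_spot a i <> None.

Definition unit_interval_parking_function (n : nat) (a : n.-tuple nat) : Prop :=
  parking_function a /\
  forall i : 'I_n, park_spot a i = Some (tnth a i) \/
                   park_spot a i = Some (tnth a i).+1.

Definition lucky (n : nat) (a : n.-tuple nat) (i : 'I_n) : bool :=
  park_spot a i == Some (tnth a i).

Definition num_lucky (n : nat) (a : n.-tuple nat) : nat :=
  #|[pred i : 'I_n | lucky a i]|.

Definition UPF_T1 (n : nat) (S : set nat) : set (n.-tuple nat) :=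
  [set a | unit_interval_parking_function a /\ S (num_lucky a)].

Definition next_value (b : seq nat) (x y : nat) : Prop :=
  [/\ y \in b, x < y & forall z, z \in b -> x < z -> y <= z].

Definition fubini_ranking (n : nat) (b : n.-tuple nat) : Prop :=
  [/\ in_range b,
      exists i : 'I_n, tnth b i = 1 &
      forall x y : nat, x \in b -> next_value b x y -> y = x + count_mem x b].

Definition num_ranks (n : nat) (b : n.-tuple nat) : nat := size (undup b).

Definition FR_T1 (n : nat) (S : set nat) : set (n.-tuple nat) :=
  [set b | fubini_ranking b /\ S (num_ranks b)].

Arguments UPF_T1 n S : clear implicits.
Arguments FR_T1 n S : clear implicits.

(* Main.v *)
Require Import Defs.
From mathcomp Require Import all_boot.
From mathcomp Require Import boolp classical_sets functions.
From mathcomp Require Import zify.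

(** A Fubini ranking [b] determines the stable order of the cars: first by rank,
    then by index.  Send each car to its position in that order.  If car [i] is the
    first car of its rank, its preference is that position; otherwise its
    preference is the position just before, which the previous car of the same
    rank occupies already.  The cars then park exactly in the stable order, and
    the lucky ones are the first cars of each rank.  Conversely, from a unit
    interval parking function the rank of a car is recovered as the largest
    lucky spot not exceeding the spot of the car. *)

Local Open Scope classical_set_scope.

(** * Parking spots described by the earlier cars alone *)

Lemma first_freeP (n : nat) (occ : seq nat) (x p : nat) :
  first_free n occ x = Some p <->
  [/\ x <= p <= n, p \notin occ & forall s, x <= s < p -> s \in occ].
Proof.
rewrite /first_free; split.
  have : x + (n.+1 - x) = maxn n.+1 x by lia.
  move: (n.+1 - x) => k; elim: k x => [|k IH] x //= xk.
  case: ifPn => [xocc [<-]|/negPn xocc]; first by split=> // [|s]; lia.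
  case/IH => [|xp pocc sub]; first lia.
  split=> // [|s xs]; first lia.
  have [->//|sx] := eqVneq s x.
  by apply: sub; lia.
case=> /andP[xp pn] pocc sub.
have -> : n.+1 - x = (p - x) + (n.+1 - p) by lia.
rewrite iotaD filter_cat.
have -> : [seq s <- iota x (p - x) | s \notin occ] = [::].
  apply/eqP; rewrite -[_ == _]negbK -has_filter; apply/hasPn => s.
  by rewrite mem_iota negbK => sp; apply: sub; lia.
rewrite subnKC //; have -> : n.+1 - p = (n - p).+1 by lia.
by rewrite /= pocc.
Qed.

Lemma size_outcome (n : nat) (occ a : seq nat) :
  size (outcome n occ a) = size a.
Proof. by elim: a occ => //= x a IH occ; rewrite IH. Qed.

(** Only membership in [occ'] is specified, since [first_free] does not depend on the order of the
    occupied spots. *)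
Lemma nth_outcome (n : nat) (occ a : seq nat) (i : nat) : i < size a ->
  exists2 occ', forall s, (s \in occ') =
      (s \in occ) || (Some s \in take i (outcome n occ a)) &
    nth None (outcome n occ a) i = first_free n occ' (nth 0 a i).
Proof.
elim: a occ i => [//|x a IH] occ [|i] /= ia.
  by exists occ => // s; rewrite in_nil orbF.
set occ1 := if first_free n occ x is Some p then p :: occ else occ.
have [occ' occ'E ->] := IH occ1 i ia.
exists occ' => // s; rewrite occ'E /occ1 inE.
case: (first_free n occ x) => [p|] //.
by rewrite inE -orbA orbCA.
Qed.

Lemma park_spotP (n : nat) (a : n.-tuple nat) (i : 'I_n) (p : nat) :
  park_spot a i = Some p <->
  [/\ tnth a i <= p <= n,
      forall j : 'I_n, j < i -> park_spot a j <> Some p &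
      forall s, tnth a i <= s < p ->
        exists2 j : 'I_n, j < i & park_spot a j = Some s].
Proof.
have ia : i < size a by rewrite size_tuple.
have [occ occE E] := nth_outcome n [::] a i ia.
have occP s : s \in occ <-> exists2 j : 'I_n, j < i & park_spot a j = Some s.
  have it : i <= size (outcome n [::] a) by rewrite size_outcome ltnW.
  rewrite occE in_nil /=; split.
    case/(nthP None) => j; rewrite size_takel // => ji.
    rewrite nth_take // => jE.
    by exists (Ordinal (ltn_trans ji (ltn_ord i))).
  case=> j ji jE; apply/(nthP None); exists j; first by rewrite size_takel.
  by rewrite nth_take.
rewrite {1}/park_spot E -tnth_nth; split.
  case/first_freeP => xp pocc sub; split=> // [j ji jE|s /sub /occP//].
  by move/negP: pocc; apply; apply/occP; exists j.
case=> xp pocc sub; apply/first_freeP; split=> // [|s /sub /occP//].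
by apply/negP => /occP[j /pocc].
Qed.

Lemma ord_ltn_ind (n : nat) (P : 'I_n -> Prop) :
  (forall i : 'I_n, (forall j : 'I_n, j < i -> P j) -> P i) -> forall i, P i.
Proof.
move=> IH i; have [m] := ubnP (i : nat).
elim: m i => [//|m IHm] i im; apply: IH => j ji; apply: IHm.
exact: leq_trans ji _.
Qed.

Lemma count_tuple (n : nat) (b : n.-tuple nat) (P : pred nat) :
  count P b = #|[pred i : 'I_n | P (tnth b i)]|.
Proof.
by rewrite -{1}(map_tnth_enum b) count_map cardE size_filter -enumT.
Qed.

(** An injection of [n] cars into [n] spots is onto, so every spot below [q i] is taken. *)
Lemma card_ltn_injective (n : nat) (q : 'I_n -> nat) :
  injective q -> (forall i, 0 < q i <= n) ->
  forall i, q i = #|[pred j | q j < q i]|.+1.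
Proof.
move=> qI qn i.
have qlt j : (q j).-1 < n by have := qn j; lia.
pose r j := Ordinal (qlt j).
have rI : injective r.
  by move=> j k /(congr1 val) /= jk; apply: qI; have := qn j; have := qn k; lia.
have -> : #|[pred j | q j < q i]| = #|[pred k : 'I_n | k < r i]|.
  rewrite -[RHS](on_card_preimset (f := r)); last first.
    by apply: onW_bij; apply: injF_bij.
  rewrite cardsE; apply: eq_card => j; rewrite !inE /=.
  by have := qn j; have := qn i; lia.
have rn : r i <= n by rewrite ltnW.
suff -> : #|[pred k : 'I_n | k < r i]| = r i by have := qn i; rewrite /=; lia.
by rewrite -sum1_card (big_ord_narrow rn) sum1_card card_ord.
Qed.

(** * Competition rankings and their stable order *)

Definition prior_ties (n : nat) (b : n.-tuple nat) (i : 'I_n) : nat :=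
  #|[pred j : 'I_n | (j < i) && (tnth b j == tnth b i)]|.

Definition stable_before (n : nat) (b : n.-tuple nat) (j i : 'I_n) : bool :=
  (tnth b j < tnth b i) || (j < i) && (tnth b j == tnth b i).

Definition stable_spot (n : nat) (b : n.-tuple nat) (i : 'I_n) : nat :=
  tnth b i + prior_ties n b i.

(* Truncation [0.-1 = 0] makes the first car of a rank prefer its own spot. *)
Definition upf_of_ranking (n : nat) (b : n.-tuple nat) : n.-tuple nat :=
  [tuple tnth b i + (prior_ties n b i).-1 | i < n].

(** Global form of the gap condition: a rank is one more than the number of strictly better cars. *)
Definition competition_ranking (n : nat) (b : n.-tuple nat) : Prop :=
  forall i, tnth b i = #|[pred j : 'I_n | tnth b j < tnth b i]|.+1.

Lemma card_orb_disjoint (T : finType) (P Q : pred T) :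
  (forall x, P x -> ~~ Q x) ->
  #|[pred x | P x || Q x]| = #|P| + #|Q|.
Proof.
move=> PQ; rewrite -cardUI [X in _ = _ + X]eq_card0 ?addn0 //.
by move=> x; rewrite !inE; apply/negP => /andP[/PQ/negP].
Qed.

Lemma fubini_rankingP (n : nat) (b : n.-tuple nat) : 0 < n ->
  fubini_ranking b <-> competition_ranking n b.
Proof.
move=> n0; split.
  case=> rng [i0 i01] nxt.
  suff H m i : tnth b i < m -> tnth b i = #|[pred j | tnth b j < tnth b i]|.+1.
    by move=> i; apply: (H (tnth b i).+1).
  elim: m i => [//|m IH] i im.
  have [i1|i1] := leqP (tnth b i) 1.
    rewrite eq_card0; first by have := rng i; lia.
    by move=> j; rewrite !inE; have := rng j; lia.
  have P0 : tnth b i0 < tnth b i by rewrite i01.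
  (* The car [k] has the largest rank below that of [i]. The rank of [i] is then the next value, and
     the cars better than [i] are those better than [k] together with those tied with [k]. *)
  case: (@arg_maxnP _ i0 (fun j => tnth b j < tnth b i)
          (fun j => tnth b j) P0) => k ki kmax.
  have E : tnth b i = tnth b k + count_mem (tnth b k) b.
    apply: nxt; first exact: mem_tnth.
    split=> //; first exact: mem_tnth.
    move=> z /tnthP[j ->] kj; rewrite leqNgt; apply/negP => ji.
    by have := kmax j ji; rewrite /= leqNgt kj.
  rewrite {1}E count_tuple {1}(IH k); last lia.
  rewrite addSn -card_orb_disjoint; last by move=> j /=; lia.
  congr _.+1; apply: eq_card => j; rewrite !inE.
  by apply/idP/idP => [|/kmax /=]; lia.
move=> cr; have rng : in_range b.
  (* Car [i] is not counted among its betters, so the count is below [n]. *)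
  move=> i; rewrite cr /=.
  rewrite -[X in _ < X](card_ord n); apply: proper_card.
  apply/properP; split; first by apply/fintype.subsetP.
  by exists i; rewrite // !inE ltnn.
split=> //.
  case: (@arg_minnP _ (Ordinal n0) predT (fun j => tnth b j) isT) => k _ kmin.
  exists k; rewrite cr eq_card0 // => j; rewrite !inE.
  by have /= := kmin j isT; lia.
move=> _ _ /tnthP[i ->] [/tnthP[k ->] ik kmin].
have {}ik : tnth b i < tnth b k := ik.
have {}kmin j : tnth b i < tnth b j -> tnth b k <= tnth b j := kmin _ (mem_tnth j b).
rewrite {1}(cr k) {1}(cr i) count_tuple addSn -card_orb_disjoint; last first.
  by move=> j /=; lia.
congr _.+1; apply: eq_card => j; rewrite !inE.
by rewrite /=; have := kmin j; lia.
Qed.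

Lemma stable_spotE (n : nat) (b : n.-tuple nat) :
  competition_ranking n b ->
  forall i, stable_spot n b i = #|[pred j | stable_before n b j i]|.+1.
Proof.
move=> cr i; rewrite /stable_spot {1}cr addSn /prior_ties -card_orb_disjoint //.
by move=> j /=; lia.
Qed.

Lemma stable_before_total (n : nat) (b : n.-tuple nat) (i j : 'I_n) :
  i != j -> stable_before n b i j || stable_before n b j i.
Proof. by rewrite /stable_before -val_eqE /=; lia. Qed.

Lemma stable_spot_lt (n : nat) (b : n.-tuple nat) (j i : 'I_n) :
  competition_ranking n b ->
  stable_before n b j i -> stable_spot n b j < stable_spot n b i.
Proof.
move=> cr ji; rewrite !stable_spotE // ltnS; apply: proper_card.
apply/properP; split; last first.
  by exists j; rewrite ?inE // /stable_before; lia.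
by apply/fintype.subsetP => k; move: ji; rewrite !inE /stable_before; lia.
Qed.

Lemma stable_spot_inj (n : nat) (b : n.-tuple nat) :
  competition_ranking n b -> injective (stable_spot n b).
Proof.
move=> cr i j ij; apply/eqP; apply: contraT => /(stable_before_total n b).
by case/orP => /(stable_spot_lt n b _ _ cr); rewrite ij ltnn.
Qed.

Lemma stable_spot_le (n : nat) (b : n.-tuple nat) (i : 'I_n) :
  competition_ranking n b -> stable_spot n b i <= n.
Proof.
move=> cr; rewrite stable_spotE // -[X in _ < X](card_ord n).
apply: proper_card; apply/properP; split; first by apply/fintype.subsetP.
by exists i; rewrite // !inE /stable_before; lia.
Qed.

(** Take for [j] the latest earlier car of the same rank: the prior ties of [i] are those of [j] and
    [j] itself. *)
Lemma prior_tie_pred (n : nat) (b : n.-tuple nat) (i : 'I_n) :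
  0 < prior_ties n b i ->
  exists j : 'I_n, [/\ j < i, tnth b j = tnth b i &
    prior_ties n b i = (prior_ties n b j).+1].
Proof.
case/card_gt0P => j0 jP.
case: (@arg_maxnP _ j0 _ (fun j : 'I_n => j : nat) jP) => j /andP[ji /eqP jb] jmax.
exists j; split=> //.
rewrite /prior_ties -add1n -(card1 j) -card_orb_disjoint; last first.
  by move=> k /eqP->; rewrite /= ltnn.
apply: eq_card => k; rewrite !inE -val_eqE /= jb.
apply/idP/idP => [kP|/orP[/eqP/val_inj->|]].
- by have /= := jmax k kP; lia.
- by rewrite ji jb eqxx.
- by lia.
Qed.

(** * From rankings to parking functions *)

Lemma park_spot_upf_of_ranking (n : nat) (b : n.-tuple nat) :
  competition_ranking n b ->
  forall i, park_spot (upf_of_ranking n b) i = Some (stable_spot n b i).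
Proof.
move=> cr; apply: ord_ltn_ind => i IH; apply/park_spotP.
rewrite tnth_mktuple; split=> [|j ji|s].
- by rewrite stable_spot_le // /stable_spot; lia.
- by rewrite IH // => -[/(stable_spot_inj n b cr) jE]; rewrite jE ltnn in ji.
(* Such an [s] exists only if [i] has a prior tie; it is then the spot just before that of [i], held
   by the previous car of the same rank. *)
- rewrite /stable_spot => si.
  have [|j [ji jb jc]] := prior_tie_pred n b i; first lia.
  by exists j => //; rewrite IH // /stable_spot; congr Some; lia.
Qed.

Lemma upf_of_ranking_upf (n : nat) (b : n.-tuple nat) :
  competition_ranking n b -> unit_interval_parking_function (upf_of_ranking n b).
Proof.
move=> cr; have E := park_spot_upf_of_ranking n b cr.
split; last first.
  move=> i; rewrite E tnth_mktuple /stable_spot.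
  case: (prior_ties n b i) => [|c]; first by left; rewrite addn0.
  by right; rewrite addnS.
split=> i; last by rewrite E.
have := stable_spot_le n b i cr; have := cr i.
by rewrite tnth_mktuple /stable_spot; lia.
Qed.

Lemma lucky_upf_of_ranking (n : nat) (b : n.-tuple nat) (i : 'I_n) :
  competition_ranking n b ->
  lucky (upf_of_ranking n b) i = (prior_ties n b i == 0).
Proof.
move=> cr; rewrite /lucky park_spot_upf_of_ranking // tnth_mktuple.
by rewrite (inj_eq Some_inj) /stable_spot; lia.
Qed.

(** Each rank has exactly one lucky car, its earliest, so [tnth b] maps the lucky cars bijectively
    onto the ranks. *)
Lemma num_lucky_upf_of_ranking (n : nat) (b : n.-tuple nat) :
  competition_ranking n b -> num_lucky (upf_of_ranking n b) = num_ranks b.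
Proof.
move=> cr; rewrite /num_lucky /num_ranks cardE -(size_map (tnth b)).
have luckyP i j : lucky (upf_of_ranking n b) i -> tnth b j = tnth b i -> i <= j.
  rewrite lucky_upf_of_ranking // => /eqP/card0_eq/(_ j).
  by rewrite !inE => jP jb; move: jP; rewrite jb eqxx andbT; lia.
apply/perm_size/uniq_perm; last 1 first.
- move=> x; rewrite mem_undup; apply/mapP/idP => [[i _ ->]|/tnthP[i ->]].
    exact: mem_tnth.
  case: (@arg_minnP _ i (fun j => tnth b j == tnth b i)
          (fun j : 'I_n => j : nat) (eqxx _)) => j /eqP jb jmin.
  exists j => //; rewrite mem_enum inE lucky_upf_of_ranking //.
  apply/eqP/eq_card0 => k; rewrite !inE jb; apply/negP => /andP[kj kb].
  by have /= := jmin k kb; lia.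
- rewrite map_inj_in_uniq ?enum_uniq // => i j.
  rewrite !mem_enum !inE => il jl ij; apply/val_inj/eqP; rewrite eqn_leq /=.
  by rewrite !luckyP.
- exact: undup_uniq.
Qed.

(* The spots, hence the lucky cars, are read off the parking function; a lucky
   car reveals its rank, and any other car has the rank of the car parked just
   before it, which arrived earlier. *)
Lemma upf_of_ranking_inj (n : nat) (b c : n.-tuple nat) :
  competition_ranking n b -> competition_ranking n c ->
  upf_of_ranking n b = upf_of_ranking n c -> b = c.
Proof.
move=> crb crc bc; apply: eq_from_tnth.
have spE i : stable_spot n b i = stable_spot n c i.
  by apply: Some_inj; rewrite -!park_spot_upf_of_ranking // bc.
have luE i : (prior_ties n b i == 0) = (prior_ties n c i == 0).
  by rewrite -!lucky_upf_of_ranking // bc.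
apply: ord_ltn_ind => i IH.
have := spE i; have := luE i; rewrite /stable_spot.
have [->|bi] := posnP (prior_ties n b i); first by lia.
have [->|ci _ spi] := posnP (prior_ties n c i); first by lia.
have [j [ji jb jbc]] := prior_tie_pred n b i bi.
have [k [ki kc kcc]] := prior_tie_pred n c i ci.
have jk : j = k.
  by apply: (stable_spot_inj n b crb); rewrite [RHS]spE /stable_spot; lia.
by rewrite -jb IH // jk.
Qed.

(** * Recovering the ranking from a parking function *)

Lemma upf_park_spots (n : nat) (a : n.-tuple nat) :
  unit_interval_parking_function a ->
  exists q : 'I_n -> nat,
    [/\ forall i, park_spot a i = Some (q i), injective q,
        forall i, 0 < q i <= n &
        forall i, q i = tnth a i \/
          q i = (tnth a i).+1 /\ exists2 j : 'I_n, j < i & q j = tnth a i].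
Proof.
case=> -[rng _] ui.
(* The default 0 is never reached, because every car parks. *)
exists (fun i => odflt 0 (park_spot a i)).
have E i : park_spot a i = Some (odflt 0 (park_spot a i)).
  by case: (ui i) => ->.
split=> // [i j|i|i].
- wlog ij : i j / j <= i.
    move=> H qij; case: (leqP j i) => [ji|/ltnW ij]; first exact: H.
    by apply: esym; apply: H.
  move=> qij; have /park_spotP[_ H _] := E i.
  apply/val_inj/eqP; rewrite eq_sym eqn_leq ij /= leqNgt; apply/negP => /H.
  by rewrite qij -E.
- by have /park_spotP[H _ _] := E i; have := rng i; lia.
- have /park_spotP[_ _ H] := E i.
  case: (ui i) H => -> /= H; [by left|right; split=> //].
  by have [|j ji jE] := H (tnth a i); [lia|exists j; rewrite ?jE].
Qed.

Lemma upf_of_ranking_surj (n : nat) (a : n.-tuple nat) :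
  unit_interval_parking_function a ->
  exists2 b, competition_ranking n b & upf_of_ranking n b = a.
Proof.
case/upf_park_spots => q [_ qI qn qa].
pose lk j := q j == tnth a j.
pose r i := \max_(j | lk j && (q j <= q i)) q j.
pose b := [tuple r i | i < n].
have rle i : r i <= q i by apply/bigmax_leqP => j /andP[].
have rge i j : lk j -> q j <= q i -> q j <= r i.
  by move=> jl ji; apply: leq_bigmax_cond; rewrite jl.
have rmono i j : q i <= q j -> r i <= r j.
  move=> ij; apply/bigmax_leqP => k /andP[kl ki].
  by apply: rge => //; apply: leq_trans ij.
have nlk i : ~~ lk i -> exists2 j : 'I_n, j < i & q i = (q j).+1.
  by case: (qa i) => [qi|[-> [j ji <-]]]; [rewrite /lk qi eqxx|exists j].
(* The maximum defining [r i] is over a nonempty set: stepping from an unlucky car to the car parked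
   just before it must end at a lucky car. *)
have rlk i : exists2 k, lk k & r i = q k.
  have [|k] := @eq_bigmax_cond _ [pred j | lk j && (q j <= q i)] q.
    have [m] := ubnP (q i); elim: m i => [//|m IH] i im.
    have [il|/nlk[j _ qij]] := boolP (lk i).
      by apply/card_gt0P; exists i; rewrite inE il leqnn.
    have jm : q j < m by lia.
    have /card_gt0P[k] := IH j jm.
    by rewrite inE => /andP[kl kj]; apply/card_gt0P; exists k; rewrite inE kl; lia.
  by rewrite inE => /andP[kl _] kE; exists k.
(* Within a rank, the cars fill their spots from left to right. *)
have earlier m i j : q i < m -> r j = r i -> q j < q i -> j < i.
  elim: m i => [//|m IH] i im rji ji.
  (* A lucky [i] would have [r i = q i > q j >= r j], contradicting the tie. Otherwise the car [k]
     just before [i] is [j] itself, or lies between them and shares their rank by monotonicity of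
     [r]. *)
  have [il|/nlk[k ki qik]] := boolP (lk i).
    by have := rge i i il (leqnn _); have := rle j; lia.
  have [/qI->//|jk] := eqVneq (q j) (q k).
  apply: ltn_trans ki; apply: IH; [lia| |lia].
  by have := rmono j k; have := rmono k i; lia.
have order j i : stable_before n b j i = (q j < q i).
  rewrite /stable_before !tnth_mktuple; apply/idP/idP => [ji|ji].
    rewrite ltnNge; apply/negP => ij.
    case/orP: ji => [|/andP[ji /eqP rji]]; first by have := rmono i j ij; lia.
    have [/qI jE|nij] := eqVneq (q i) (q j); first by rewrite jE ltnn in ji.
    by have := earlier (q j).+1 j i (leqnn _) (esym rji); lia.
  by have := rmono j i; have := earlier _ i j (leqnn _); lia.
have cr : competition_ranking n b.
  (* As [k] is lucky, [r j < q k] holds exactly when [q j < q k], so the better cars fill the spots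
     below [q k]. *)
  move=> i; have [k kl ik] := rlk i.
  rewrite tnth_mktuple ik {1}(card_ltn_injective n q qI qn k); congr _.+1.
  apply: eq_card => j; rewrite !inE tnth_mktuple.
  by have := rge j k kl; have := rle j; lia.
exists b => //; apply: eq_from_tnth => i.
have : stable_spot n b i = q i.
  rewrite stable_spotE // (card_ltn_injective n q qI qn i); congr _.+1.
  by apply: eq_card => j; rewrite !inE order.
rewrite /stable_spot !tnth_mktuple.
have [il|il] := boolP (lk i).
  by have := rge i i il (leqnn _); have := rle i; move/eqP: il; lia.
(* An unlucky car does not hold a lucky spot, so it has a prior tie and the truncated predecessor is
   a genuine one. *)
have : r i != q i.
  by have [k kl ->] := rlk i; apply: contraNneq il => /qI<-.
by move/eqP: il; case: (qa i) => [|[]]; lia.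
Qed.

Theorem theorem3p5 (n : nat) (hn : 0 < n) (S : set nat)
    (hS : forall k : nat, S k -> 0 < k) :
  exists f : n.-tuple nat -> n.-tuple nat,
    set_bij (FR_T1 n S) (UPF_T1 n S) f.
Proof.
exists (upf_of_ranking n); split.
- move=> b [/(fubini_rankingP n b hn) cr Sb]; split; first exact: upf_of_ranking_upf.
  by rewrite num_lucky_upf_of_ranking.
- move=> b c /set_mem[/(fubini_rankingP n b hn) crb _].
  by move=> /set_mem[/(fubini_rankingP n c hn) crc _]; apply: upf_of_ranking_inj.
- move=> a [/upf_of_ranking_surj[b cr <-] Sa]; exists b => //; split.
    exact/fubini_rankingP.
  by rewrite -num_lucky_upf_of_ranking.
Qed.
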